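(* Let $\Omega$ be a set and $\mathcal{K}\subset\mathbb{R}^\Omega$ a convex cone. Let $$\mathscr{M}(\mathcal{K})=\Big\{m\in\mathbb{P}_{ba}:\ \mathcal{K}\subset L(m),\ \sup_{k\in\mathcal{K}}m(k)\leq0\Big\}.$$ Then $\mathscr{M}(\mathcal{K})$ is non empty if and only if there exist an algebra $\mathscr{A}\subset2^{\Omega}$ and $\mu\in\mathbb{P}_{ba}(\mathscr{A})$ such that $\mathcal{K}\subset L(\mu)$ and that the closure $\overline{C}^{\mu}$ of $C=\mathcal{K}-\mathscr{S}(\mathscr{A})_+$ in the norm topology of $L(\mu)$ admits no sure wins.
   Context: A convex cone is a (nonempty) set $\mathcal{K}\subset\mathbb{R}^\Omega$ such that $f+g,\lambda f\in\mathcal{K}$ whenever $f,g\in\mathcal{K}$ and $\lambda\geq0$. Functions are ordered pointwise. A sure win is a function $f\in\mathbb{R}^\Omega$ with $f\geq1$ pointwise on $\Omega$; a set admits no sure wins if it contains none. $\mathbb{P}_{ba}(\mathscr{A})$ is the set of finitely additive probabilities on the algebra $\mathscr{A}$ (nonnegative finitely additive set functions on $\mathscr{A}$ with total mass $1$), and $\mathbb{P}_{ba}=\mathbb{P}_{ba}(2^\Omega)$. $\mathscr{S}(\mathscr{A})$ is the set of (real) $\mathscr{A}$-simple functions and $\mathscr{S}(\mathscr{A})_+$ its nonnegative elements; $\mathcal{K}-\mathscr{S}(\mathscr{A})_+=\{k-s:k\in\mathcal{K},s\in\mathscr{S}(\mathscr{A})_+\}$. For $\mu\in\mathbb{P}_{ba}(\mathscr{A})$,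 $L(\mu)$ is the space of real-valued functions $f$ on $\Omega$ integrable with respect to $\mu$ in the finitely additive (Dunford–Schwartz) sense: there are $\mathscr{A}$-simple functions $s_n$ converging to $f$ in $\mu$-measure (using the outer set function $\mu^*(E)=\inf\{\mu(A):A\in\mathscr{A},E\subset A\}$) with $\int|s_n-s_k|\,d\mu\to0$ as $n,k\to\infty$; $\mu(f)=\lim_n\int s_n\,d\mu$ is the integral, and $L(\mu)$ has the (semi)norm $\|f\|=\mu(|f|)$. *)

(* Defs.v *)
From HB Require Import structures.
From mathcomp Require Import all_boot all_order all_algebra.
From mathcomp Require Import all_classical all_reals all_analysis.

Set Implicit Arguments.
Unset Strict Implicit.
Unset Printing Implicit Defensive.

Import Order.TTheory GRing.Theory Num.Theory.
Import numFieldNormedType.Exports.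

Local Open Scope classical_set_scope.
Local Open Scope ring_scope.

(* Algebras of subsets of Omega are sets of sets and set functions are total
   maps [set Omega -> R], so that one can quantify existentially over the
   algebra.  Only the values of [mu] on the algebra [A] matter below. *)

Section FinitelyAdditiveIntegral.
Context {R : realType} {Omega : Type}.
Implicit Types (A : set (set Omega)) (mu : set Omega -> R) (f g : Omega -> R).

Definition set_algebra A : Prop := setring A /\ A setT.

Definition fa_probability A mu : Prop :=
  [/\ forall E, A E -> 0 <= mu E,
      forall E F, A E -> A F -> E `&` F = set0 -> mu (E `|` F) = mu E + mu F
    & mu setT = 1].

Definition simple A : set (Omega -> R) :=
  [set s | finite_set (range s) /\ forall x, A (s @^-1` [set x])].

Definition simple_nneg A : set (Omega -> R) :=
  [set s | simple A s /\ forall w, 0 <= s w].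

(* Meaningful when [f] has finite range. *)
Definition simple_integral mu f : R :=
  \sum_(x \in range f) x * mu (f @^-1` [set x]).

Definition outer A mu (E : set Omega) : R :=
  inf [set mu F | F in [set F | A F /\ E `<=` F]].

Definition cvg_in_measure A mu (s : nat -> Omega -> R) f : Prop :=
  forall e : R, 0 < e ->
    outer A mu [set w | e < `|s n w - f w|] @[n --> \oo] --> 0.

Definition determining A mu (s : nat -> Omega -> R) f : Prop :=
  [/\ forall n, simple A (s n),
      cvg_in_measure A mu s f
    & simple_integral mu (fun w => `|s p.1 w - s p.2 w|)
        @[p --> (\oo, \oo)] --> 0].

(* L(mu), integrability in the sense of Dunford and Schwartz. *)
Definition integrable_fa A mu : set (Omega -> R) :=
  [set f | exists s, determining A mu s f].

(* For [f] in L(mu) the limit does not depend on the determining sequence;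
   outside L(mu) the value is arbitrary. *)
Definition fa_integral A mu f : R :=
  get [set l : R | exists2 s, determining A mu s f &
                   simple_integral mu (s n) @[n --> \oo] --> l].

Definition L1_norm A mu f : R := fa_integral A mu (fun w => `|f w|).

(* Closure of C in L(mu) for the seminorm [L1_norm]; its elements are actual
   functions on Omega, not classes modulo null functions. *)
Definition L1_closure A mu (C : set (Omega -> R)) : set (Omega -> R) :=
  [set f | integrable_fa A mu f /\
           forall e : R, 0 < e -> exists2 g, C g & L1_norm A mu (f - g) < e].

Definition convex_cone (K : set (Omega -> R)) : Prop :=
  [/\ K !=set0,
      forall f g, K f -> K g -> K (f + g)
    & forall (l : R) f, 0 <= l -> K f -> K (l *: f)].

Definition sure_win f : Prop := forall w, 1 <= f w.

Definition no_sure_wins (C : set (Omega -> R)) : Prop :=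
  ~ exists2 f, C f & sure_win f.

Definition cone_sub_simple A (K : set (Omega -> R)) : set (Omega -> R) :=
  [set k - s | k in K & s in simple_nneg A].

(* The algebra 2^Omega is [setT : set (set Omega)].  The supremum is taken in
   the extended reals, where it exists unconditionally. *)
Definition separating_probabilities (K : set (Omega -> R)) :
    set (set Omega -> R) :=
  [set m | [/\ fa_probability setT m,
               K `<=` integrable_fa setT m
             & (ereal_sup [set (fa_integral setT m k)%:E | k in K] <= 0)%E]].

End FinitelyAdditiveIntegral.

(* Main.v *)
(* If the closure of [C] has no sure win, then [1] has a positive distance [d]
   from [C]: whenever [1 <= k + h] with [k] in [K] and [0 <= h] in [L(mu)], the
   integral of [h] is at least [d].  Hence
     [inf {t + mu(h) / d | f <= t + k + h}]
   is a finite sublinear functional on the functions with finite range.  A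
   linear functional below it (Hahn-Banach) is integration against a finitely
   additive probability [m] on all subsets, and [m <= mu / d] on the algebra, so
   a sequence [s n] determining [k] in [K] for [mu] also determines it for [m].
   Since [s n <= k + `|k - s n|], the integral of [s n] against [m] is at most
   [mu `|k - s n| / d], which tends to [0]; thus [m(k) <= 0].  Conversely, for
   [m] in [M(K)] one takes the algebra of all subsets and [mu = m]: integration
   is nonpositive on [C], hence on its closure, but at least [1] on sure wins. *)
Require Import Defs.
From HB Require Import structures.
From mathcomp Require Import all_boot all_order all_algebra.
From mathcomp Require Import finmap ring lra.
From mathcomp Require Import all_classical all_reals all_analysis.

Set Implicit Arguments.
Unset Strict Implicit.
Unset Printing Implicit Defensive.

Import Order.TTheory GRing.Theory Num.Theory.
Import numFieldNormedType.Exports.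

Local Open Scope classical_set_scope.
Local Open Scope ring_scope.

(** * Hahn-Banach *)

Section HahnBanach.
Context {R : realType} {V : lmodType R}.
Implicit Types (p q : V -> R) (u v w : V).

(** Homogeneity is asked only as an inequality; scaling back by [a^-1] recovers the equality in
    [sublinear_pos]. *)
Definition sublinear p : Prop :=
  (forall u v, p (u + v) <= p u + p v) /\
  (forall (a : R) v, 0 <= a -> p (a *: v) <= a * p v).

Lemma sublinear0 p : sublinear p -> p 0 = 0.
Proof.
move=> [pD pZ]; apply/eqP; rewrite eq_le; apply/andP; split.
  by have := pZ 0 0 (lexx 0); rewrite scale0r mul0r.
by have := pD 0 0; rewrite addr0; lra.
Qed.

Lemma sublinear_opp p v : sublinear p -> - p (- v) <= p v.
Proof.
move=> sp; have := sp.1 v (- v); rewrite subrr sublinear0//; lra.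
Qed.

Lemma sublinear_pos p (a : R) v : sublinear p -> 0 <= a -> p (a *: v) = a * p v.
Proof.
move=> sp; rewrite le_eqVlt => /predU1P[<-|a0].
  by rewrite scale0r mul0r sublinear0.
apply/eqP; rewrite eq_le; apply/andP; split; first exact: sp.2 (ltW a0).
rewrite -ler_pdivlMl//.
have := sp.2 a^-1 (a *: v); rewrite scalerA mulVf ?gt_eqF// scale1r.
by apply; rewrite invr_ge0 ltW.
Qed.

(** This gives chains the bound that Zorn's lemma asks for. The infimum is finite because
    [q v >= - q (- v) >= - p (- v)]. It is subadditive because near-minimisers for [u] and for [v]
    are comparable, so the smaller of the two serves both vectors. *)
Lemma sublinear_inf_chain p (F : set (V -> R)) :
  F !=set0 -> (forall q, F q -> sublinear q) ->
  (forall q v, F q -> q v <= p v) ->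
  (forall q q', F q -> F q' -> (forall v, q v <= q' v) \/ (forall v, q' v <= q v)) ->
  let r v := inf [set q v | q in F] in
  sublinear r /\ forall q v, F q -> r v <= q v.
Proof.
move=> F0 Fs Fp Ftot r.
have lbF v : has_lbound [set q v | q in F].
  exists (- p (- v)) => _ [q Fq <-].
  rewrite (le_trans _ (sublinear_opp v (Fs _ Fq)))// lerN2; exact: Fp.
have F0' v : [set q v | q in F] !=set0 by case: F0 => q Fq; exists (q v), q.
have rle q v : F q -> r v <= q v by move=> Fq; apply: ge_inf => //; exists q.
split=> //; split=> [u v|a v].
  apply/ler_addgt0Pr => e e0; have e20 : 0 < e / 2 by rewrite divr_gt0.
  have [_ [q1 Fq1 <-] h1] := inf_adherent e20 (conj (F0' u) (lbF u)).
  have [_ [q2 Fq2 <-] h2] := inf_adherent e20 (conj (F0' v) (lbF v)).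
  rewrite -/(r u) -/(r v) in h1 h2.
  have [h|h] := Ftot _ _ Fq1 Fq2.
    have := rle _ (u + v) Fq1; have := (Fs _ Fq1).1 u v; have := h v; lra.
  have := rle _ (u + v) Fq2; have := (Fs _ Fq2).1 u v; have := h u; lra.
rewrite le_eqVlt => /predU1P[<-|a0].
  case: F0 => q Fq; rewrite scale0r mul0r.
  by rewrite (le_trans (rle _ _ Fq))// sublinear0//; exact: Fs.
rewrite -ler_pdivrMl//; apply: lb_le_inf => // _ [q Fq <-].
rewrite ler_pdivrMl// (le_trans (rle _ _ Fq))//.
by apply: (Fs _ Fq).2; exact: ltW.
Qed.

(* For a fixed direction [v] this sublinear functional lies below [q], and
   [r w <= q (w + v) - q v]; so if [q] is minimal it is additive. *)
Lemma sublinear_inf_dir q v : sublinear q ->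
  let r w := inf [set q (w + t *: v) - t * q v | t in [set t | 0 <= t]] in
  sublinear r /\ forall w (t : R), 0 <= t -> r w <= q (w + t *: v) - t * q v.
Proof.
move=> sq r.
have lbF w : has_lbound [set q (w + t *: v) - t * q v | t in [set t | 0 <= t]].
  exists (- q (- w)) => _ [t t0 <-].
  have := sq.1 (w + t *: v) (- w).
  by rewrite addrAC subrr add0r sublinear_pos//; lra.
have F0 w : [set q (w + t *: v) - t * q v | t in [set t | 0 <= t]] !=set0.
  by exists (q (w + 0 *: v) - 0 * q v), 0 => //=.
have rle w (t : R) : 0 <= t -> r w <= q (w + t *: v) - t * q v.
  by move=> t0; apply: ge_inf => //; exists t.
split=> //; split=> [u w|a w].
  apply/ler_addgt0Pr => e e0; have e20 : 0 < e / 2 by rewrite divr_gt0.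
  have [_ [t1 t10 <-] h1] := inf_adherent e20 (conj (F0 u) (lbF u)).
  have [_ [t2 t20 <-] h2] := inf_adherent e20 (conj (F0 w) (lbF w)).
  rewrite -/(r u) -/(r w) in h1 h2.
  have := rle (u + w) (t1 + t2) (addr_ge0 t10 t20).
  rewrite scalerDl addrACA.
  have := sq.1 (u + t1 *: v) (w + t2 *: v); lra.
rewrite le_eqVlt => /predU1P[<-|a0].
  rewrite scale0r mul0r (le_trans (rle _ _ (lexx 0)))//.
  by rewrite scale0r mul0r addr0 sublinear0// subr0.
rewrite -ler_pdivrMl//; apply: lb_le_inf => // _ [t t0 <-].
rewrite ler_pdivrMl//.
(* Replacing the parameter [t] by [a * t] makes the whole expression scale by [a]. *)
have at0 : 0 <= a * t by rewrite mulr_ge0// ltW.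
rewrite (le_trans (rle _ _ at0))// -scalerA -scalerDr.
by rewrite (sublinear_pos _ sq (ltW a0)) mulrBr mulrA.
Qed.

(* A minimal sublinear functional below [p], which Zorn's lemma provides, is
   linear. *)
Lemma hahn_banach p : sublinear p ->
  exists g : {scalar V}, forall v, g v <= p v.
Proof.
move=> sp; pose T := {q : V -> R | sublinear q /\ forall v, q v <= p v}.
(* The order is reversed, so a maximal element in Zorn's sense is a minimal functional. *)
pose le_fun (q q' : T) := `[< forall v, sval q' v <= sval q v >].
have t0 : T by exists p.
have [|r s t /asboolP rs /asboolP st|F Ftot|] := ZL_preorder t0 (R := le_fun).
- by move=> t; apply/asboolP.
- by apply/asboolP => v; exact: le_trans (st v) (rs v).
- have [[t Ft]|F0] := pselect (F !=set0); last first.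
    by exists t0 => s Fs; case: F0; exists s.
  have [||||sr rle] := @sublinear_inf_chain p [set sval q | q in F].
  + by exists (sval t), t.
  + by move=> _ [[q []] ? ? ? <-].
  + by move=> _ v [[q []] ? ? ? <-].
  + move=> _ _ [q Fq <-] [q' Fq' <-].
    by have [/asboolP|/asboolP] := Ftot _ _ Fq Fq'; [right|left].
  set r := (fun v => inf _) in sr rle.
  have rp v : r v <= p v.
    apply: (le_trans (rle (sval t) v _)); first by exists t.
    by case: t {Ft} => q [].
  exists (exist _ r (conj sr rp)) => s Fs; apply/asboolP => v /=.
  by apply: rle; exists s.
move=> [q [sq qp]] qmin.
have qD w v : q (w + v) = q w + q v.
  apply/eqP; rewrite eq_le sq.1/=.
  have [] := sublinear_inf_dir v sq; set r := (fun w => inf _) => sr rle.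
  have rq w' : r w' <= q w'.
    by rewrite (le_trans (rle w' 0 _))// scale0r mul0r addr0 subr0.
  have rp w' : r w' <= p w' by exact: le_trans (qp w').
  have := qmin (exist _ r (conj sr rp)).
  move=> /(_ _)/asboolP/= h; have {h} qr w' : q w' <= r w'.
    by apply: h; apply/asboolP.
  have := rle w 1 ler01; rewrite scale1r mul1r; have := qr w; lra.
have qN v : q (- v) = - q v.
  by have := qD v (- v); rewrite subrr sublinear0//; lra.
have qZ (a : R) v : q (a *: v) = a * q v.
  have [a0|a0] := leP 0 a; first by rewrite sublinear_pos.
  rewrite -[a]opprK scaleNr qN sublinear_pos ?oppr_ge0 1?ltW//.
  by rewrite !mulNr.
have qlin : scalar q by move=> a u v; rewrite qD qZ.
pose G : {scalar V} := HB.pack q (GRing.isLinear.Build R V R *%R q qlin).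
by exists G.
Qed.

End HahnBanach.

(** * Integration of simple functions *)

Section SimpleIntegral.
Context {R : realType} {Omega : Type}.
Variables (A : set (set Omega)) (mu : set Omega -> R).
Hypotheses (algA : set_algebra A) (prob_mu : fa_probability A mu).
Implicit Types (f g s : Omega -> R).

(** With an arbitrary codomain, two simple functions become one map into pairs, and
    [phi (f w) (g w)] is a function of that single map. *)
Definition simple_map (T : Type) (h : Omega -> T) : Prop :=
  finite_set (range h) /\ forall t, A (h @^-1` [set t]).

Lemma algebra_preimage (T : Type) (h : Omega -> T) (D : set T) :
  simple_map h -> A (h @^-1` D).
Proof.
move=> [hfin hA]; case: algA => -[A0 AU _] _.
have -> : h @^-1` D = \bigcup_(t in range h `&` D) h @^-1` [set t].
  apply/seteqP; split=> [w Dw|w [t [_ Dt] /= ->//]].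
  by exists (h w).
have [+ _] := fin_bigcup_closedP A; move=> /(_ (conj A0 AU)); apply=> //.
exact: finite_setIl.
Qed.

Lemma simple_map_comp (T U : Type) (h : Omega -> T) (phi : T -> U) :
  simple_map h -> simple_map (phi \o h).
Proof.
move=> sh; split; first by rewrite -(image_comp h phi); apply: finite_image; case: sh.
by move=> u; rewrite comp_preimage; exact: algebra_preimage.
Qed.

Lemma simple_map_pair (T U : Type) (h : Omega -> T) (k : Omega -> U) :
  simple_map h -> simple_map k -> simple_map (fun w => (h w, k w)).
Proof.
move=> [hfin hA] [kfin kA]; split.
  apply: (@sub_finite_set _ _ (range h `*` range k)).
    by move=> _ [w _ <-]; split; exists w.
  exact: finite_setX.
move=> [t u].
have -> : (fun w => (h w, k w)) @^-1` [set (t, u)] =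
    h @^-1` [set t] `&` k @^-1` [set u].
  by apply/seteqP; split=> w /=; [move=> [-> ->]|move=> [-> ->]].
case: algA => -[_ _ AD] _; rewrite -setDD.
by apply: (AD) => //; exact: AD.
Qed.

Lemma fa_set0 : mu set0 = 0.
Proof.
case: algA prob_mu => -[A0 _ _] _ [_ muU _].
by have := muU _ _ A0 A0 (setI0 _); rewrite setU0; lra.
Qed.

Lemma fa_preimage (T : choiceType) (h : Omega -> T) (D : set T) :
  simple_map h ->
  mu (h @^-1` D) = \sum_(t \in range h `&` D) mu (h @^-1` [set t]).
Proof.
move=> sh; have fin : finite_set (range h `&` D) by apply: finite_setIl; case: sh.
(* Only attained values matter, so [D] becomes finite and can be enumerated for an induction on
   finite additivity. *)
have -> : h @^-1` D = h @^-1` (range h `&` D).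
  by apply/seteqP; split=> w //=; [move=> Dw; split=> //; exists w|move=> []].
move: (range h `&` D) fin => {}D fin.
rewrite fsbig_finite// -{1}(fset_setK fin).
have -> : [set` fset_set D] = [set` enum_fset (fset_set D)] by [].
case: prob_mu => _ muU _.
elim: (enum_fset (fset_set D)) (fset_uniq (fset_set D)) => [_|x r IH /=/andP[xr ur]].
  by rewrite big_nil set_nil preimage_set0 fa_set0.
have -> : [set` x :: r] = [set x] `|` [set` r].
  apply/seteqP; split=> y /=; rewrite inE.
    by move=> /predU1P[->|]; [left|right].
  by move=> [->|->]; rewrite ?eqxx ?orbT.
rewrite big_cons -IH// preimage_setU muU//; try exact: algebra_preimage.
apply/seteqP; split=> // w [/= -> xr']; by rewrite xr' in xr.
Qed.

(** Change of variables: each level set of [phi \o h] splits into fibres of [h], and after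
    exchanging the two finite sums only [x = phi t] survives for each [t]. Functions of a common [h]
    thus have integrals over one index set, where linearity is termwise. *)
Lemma simple_integral_comp (T : choiceType) (h : Omega -> T) (phi : T -> R) :
  simple_map h -> simple_integral mu (fun w => phi (h w)) =
                  \sum_(t \in range h) phi t * mu (h @^-1` [set t]).
Proof.
move=> sh; have hfin : finite_set (range h) by case: sh.
have pfin : finite_set (range (fun w => phi (h w))).
  by case: (simple_map_comp phi sh).
rewrite /simple_integral; under eq_fsbigr => x _.
  rewrite (_ : _ @^-1` _ = h @^-1` (phi @^-1` [set x]))//.
  rewrite fa_preimage// mulr_fsumr fsbig_mkcondr.
  over.
rewrite exchange_fsbig//; apply: eq_fsbigr => t /set_mem[w _ <-{t}].
rewrite (fsbigD1 (phi (h w)))/=; [|exact: pfin|by exists w].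
rewrite mem_set//= fsbig1 ?addr0// => x [_ /= xw].
by rewrite memNset//= => /esym.
Qed.

Lemma simple_integral2 f g (phi : R -> R -> R) : simple A f -> simple A g ->
  simple_integral mu (fun w => phi (f w) (g w)) =
  \sum_(t \in range (fun w => (f w, g w)))
     phi t.1 t.2 * mu ((fun w => (f w, g w)) @^-1` [set t]).
Proof.
move=> sf sg.
exact: (simple_integral_comp (fun t => phi t.1 t.2) (simple_map_pair sf sg)).
Qed.

Lemma simple2 f g (phi : R -> R -> R) : simple A f -> simple A g ->
  simple A (fun w => phi (f w) (g w)).
Proof.
move=> sf sg.
exact: (simple_map_comp (fun t => phi t.1 t.2) (simple_map_pair sf sg)).
Qed.

Lemma simple1 f (phi : R -> R) : simple A f -> simple A (fun w => phi (f w)).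
Proof. exact: (@simple_map_comp _ _ f phi). Qed.

Lemma simple_cst (a : R) : simple A (fun=> a).
Proof.
case: algA => -[A0 _ _] AT; split; first exact: finite_image_cst.
move=> x; have [->|/eqP ax] := eqVneq a x.
  by rewrite (_ : _ @^-1` _ = setT)//; apply/seteqP; split.
by rewrite (_ : _ @^-1` _ = set0)//; apply/seteqP; split.
Qed.

Lemma simple_indic E : A E -> simple A (\1_E : Omega -> R).
Proof.
case: algA => -[A0 _ AD] AT AE.
have sb : simple_map (fun w => w \in E).
  split; first exact: finite_finset.
  case; last first.
    rewrite (_ : _ @^-1` _ = setT `\` E); first exact: AD.
    by apply/seteqP; split=> w /=; [move/negbT; rewrite notin_setE|
      move=> [_ ?]; apply/negbTE; rewrite notin_setE].
  rewrite (_ : _ @^-1` _ = E)//.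
  by apply/seteqP; split=> w /=; [exact: set_mem|exact: mem_set].
rewrite (_ : \1_E = (fun b : bool => b%:R) \o (fun w => w \in E)).
  exact: simple_map_comp.
by apply/funext => w; rewrite indicE.
Qed.

Lemma simple_integralD f g : simple A f -> simple A g ->
  simple_integral mu (fun w => f w + g w) =
  simple_integral mu f + simple_integral mu g.
Proof.
move=> sf sg; have [fin _] := simple_map_pair sf sg.
rewrite (simple_integral2 (fun x y => x + y) sf sg).
rewrite (simple_integral2 (fun x y => x) sf sg).
rewrite (simple_integral2 (fun x y => y) sf sg).
by rewrite -fsbig_split//=; apply: eq_fsbigr => t _; rewrite mulrDl.
Qed.

Lemma simple_integralZ (a : R) f : simple A f ->
  simple_integral mu (fun w => a * f w) = a * simple_integral mu f.
Proof.
move=> sf; rewrite (simple_integral_comp (fun x => a * x) sf).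
by rewrite /simple_integral mulr_fsumr; apply: eq_fsbigr => x _; rewrite mulrA.
Qed.

Lemma simple_integralB f g : simple A f -> simple A g ->
  simple_integral mu (fun w => f w - g w) =
  simple_integral mu f - simple_integral mu g.
Proof.
move=> sf sg; rewrite -mulN1r -(simple_integralZ _ sg).
rewrite -(simple_integralD sf (simple1 _ sg)).
by congr simple_integral; apply/funext => w; rewrite mulN1r.
Qed.

Lemma simple_integral_ge0 f : simple A f -> (forall w, 0 <= f w) ->
  0 <= simple_integral mu f.
Proof.
move=> [_ fA] f0; apply: fsumr_ge0 => _ [w _ <-].
by case: prob_mu => mu0 _ _; rewrite mulr_ge0// mu0.
Qed.

Lemma simple_integral_le f g : simple A f -> simple A g ->
  (forall w, f w <= g w) -> simple_integral mu f <= simple_integral mu g.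
Proof.
move=> sf sg fg; rewrite -subr_ge0 -simple_integralB//.
by apply: simple_integral_ge0 => [|w]; [exact: (simple2 (fun x y => x - y))|
  rewrite subr_ge0].
Qed.

Lemma simple_integral_indic E : A E -> simple_integral mu \1_E = mu E.
Proof.
(* The range may miss 0 or 1, so the sum is widened to both values; a missing one has an empty
   fibre, of measure 0. *)
move=> AE; rewrite /simple_integral (fsbig_widen _ [set 0; 1])/=.
- rewrite fsbigU0//; [|move=> x [/= -> /esym/eqP]; by rewrite oner_eq0].
  rewrite !fsbig_set1 mul0r mul1r /= add0r; congr mu.
  apply/seteqP; split=> w /=; rewrite indicE.
    by case: (boolP (w \in E)) => [|_ /esym/eqP]; [rewrite inE|rewrite oner_eq0].
  by move=> Ew; rewrite mem_set.
- by move=> _ [w _ <-]; rewrite indicE; case: (_ \in _); [right|left].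
- move=> x [_ /= xE]; rewrite (_ : _ @^-1` _ = set0) ?fa_set0 ?mulr0//.
  by apply/seteqP; split=> // w /= wx; apply: xE; exists w.
Qed.

Lemma simple_integral_cst (a : R) : simple_integral mu (fun=> a) = a.
Proof.
case: algA => _ AT; have -> : (fun=> a) = (fun w : Omega => a * \1_setT w).
  by apply/funext => w; rewrite indicT mulr1.
rewrite simple_integralZ; last exact: simple_indic.
by rewrite simple_integral_indic//; case: prob_mu => _ _ ->; rewrite mulr1.
Qed.

Lemma ler_norm_simple_integral f : simple A f ->
  `|simple_integral mu f| <= simple_integral mu (fun w => `|f w|).
Proof.
move=> sf; have sa : simple A (fun w => `|f w|) := simple1 _ sf.
rewrite ler_norml; apply/andP; split; last first.
  by apply: simple_integral_le => // w; exact: ler_norm.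
rewrite lerNl -mulN1r -simple_integralZ//.
apply: simple_integral_le => // [|w]; first exact: simple1.
by rewrite mulN1r -normrN ler_norm.
Qed.

Lemma simple_range_bounded f : simple A f -> exists2 M, 0 <= M & forall w, `|f w| <= M.
Proof.
move=> [/finite_seqP[r fr] _]; exists (\sum_(x <- r) `|x|).
  by apply: sumr_ge0.
move=> w; have : f w \in r.
  by have : range f (f w) by [exists w]; rewrite fr.
elim: r {fr} => // x r IH; rewrite inE big_cons => /predU1P[->|/IH].
  by rewrite lerDl sumr_ge0.
by move=> h; rewrite (le_trans h)// lerDr.
Qed.

End SimpleIntegral.

(** * Dunford-Schwartz integration *)

Section Determining.
Context {R : realType} {Omega : Type}.
Variables (A : set (set Omega)) (mu : set Omega -> R).
Hypotheses (algA : set_algebra A) (prob_mu : fa_probability A mu).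
Implicit Types (f g : Omega -> R) (s t : nat -> Omega -> R).
Local Notation I := (simple_integral mu).

Lemma algebraU E F : A E -> A F -> A (E `|` F).
Proof. by case: algA => -[_ AU _] _; exact: AU. Qed.

(** Obtained by integrating the pointwise bound of the indicator of a union by the sum of the
    indicators. *)
Lemma fa_leU E F : A E -> A F -> mu (E `|` F) <= mu E + mu F.
Proof.
move=> AE AF; have AEF := algebraU AE AF.
have sE := @simple_indic R _ _ algA _ AE.
have sF := @simple_indic R _ _ algA _ AF.
rewrite -!(simple_integral_indic algA prob_mu)//.
rewrite -(simple_integralD algA prob_mu sE sF).
apply: (simple_integral_le algA prob_mu) => // [||w].
- exact: simple_indic.
- exact: (simple2 algA (fun x y => x + y)).
- rewrite !indicE in_setU; case: (_ \in E); case: (_ \in F) => /=; lra.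
Qed.

Lemma outer_ge0 E : 0 <= outer A mu E.
Proof.
case: algA prob_mu => _ AT [mu0 _ _]; apply: lb_le_inf.
  by exists (mu setT), setT.
by move=> _ [F [AF _] <-]; exact: mu0.
Qed.

(** A strict bound lets the infimum be traded for an actual cover in [A]: [setT] makes the family of
    covers nonempty and 0 bounds their measures below. *)
Lemma outer_ltP E e :
  outer A mu E < e <-> exists F, [/\ A F, E `<=` F & mu F < e].
Proof.
case: algA prob_mu => _ AT [mu0 _ _].
have lb : has_lbound [set mu F | F in [set F | A F /\ E `<=` F]].
  by exists 0 => _ [F [AF _] <-]; exact: mu0.
split=> [|[F [AF EF]]].
  by move/inf_lt => [|_ [F [AF EF] <-] Fe]; [exists (mu setT), setT|exists F].
by apply: le_lt_trans; apply: ge_inf => //; exists F.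
Qed.

(** One parameter bounds both the measure of the exceptional set and the values of [f] off it;
    [determiningP] shows that this still describes convergence in measure. *)
Definition small_in_measure (e : R) f : Prop :=
  exists F, [/\ A F, mu F < e & forall w, e < `|f w| -> F w].

Lemma determiningP s f : determining A mu s f <->
  [/\ forall n, simple A (s n),
      forall e : R, 0 < e ->
        \forall n \near \oo, small_in_measure e (fun w => s n w - f w)
    & forall e : R, 0 < e -> exists N, forall n m, (N <= n)%N -> (N <= m)%N ->
        I (fun w => `|s n w - s m w|) < e].
Proof.
split=> -[ss sm sc]; split=> //.
- move=> e e0; have /cvgr0Pnorm_lt/(_ _ e0) := sm e e0.
  apply: filterS => n; rewrite ger0_norm ?outer_ge0// => /outer_ltP[F [AF EF Fe]].
  by exists F.
- move=> e e0; have /cvgr0Pnorm_lt/(_ _ e0)[[P Q] [[N1 _ P1] [N2 _ Q2]] h] := sc.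
  exists (maxn N1 N2) => n m; rewrite !geq_max => /andP[nN1 nN2] /andP[mN1 mN2].
  rewrite (le_lt_trans (ler_norm _))//.
  by apply: (h (n, m)); split; [exact: P1|exact: Q2].
- move=> e e0; apply/cvgr0Pnorm_lt => d d0.
  (* Level [e] and tolerance [d] merge into their minimum, since lowering the level only enlarges
     the set to be covered. *)
  have ed0 : 0 < Num.min e d by rewrite lt_min e0.
  apply: filterS (sm _ ed0) => n [F [AF Fe hF]].
  rewrite ger0_norm ?outer_ge0//; apply/outer_ltP; exists F; split=> //.
    by move=> w /= ew; apply: hF; rewrite (le_lt_trans _ ew)// ge_min lexx.
  by rewrite (lt_le_trans Fe)// ge_min lexx orbT.
- apply/cvgr0Pnorm_lt => e e0; have [N hN] := sc _ e0.
  exists ([set n | (N <= n)%N], [set n | (N <= n)%N]).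
    by split; exists N.
  move=> [n m] /= [Nn Nm]; rewrite ger0_norm; first exact: hN.
  apply: (simple_integral_ge0 prob_mu) => //.
  exact: (simple2 algA (fun x y => `|x - y|)).
Qed.

(** A Lipschitz map carries both smallness off an exceptional set and the Cauchy condition, up to
    the factor [c]. Sums, differences, multiples and absolute values are all instances. *)
Lemma determining2 (c : R) (phi : R -> R -> R) s t f g : 0 <= c ->
  (forall x x' y y', `|phi x y - phi x' y'| <= c * (`|x - x'| + `|y - y'|)) ->
  determining A mu s f -> determining A mu t g ->
  determining A mu (fun n w => phi (s n w) (t n w)) (fun w => phi (f w) (g w)).
Proof.
move=> c0 lip /determiningP[ss sm sc] /determiningP[ts tm tc].
have c1 : 0 < c + 1 by lra.
have key (e : R) : 0 < e -> exists e', [/\ 0 < e', c * (e' + e') < e & e' + e' <= e].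
  (* The [+ 1] covers [c = 0] and also gives the second bound, used for the measure of the union of
     two exceptional sets. *)
  move=> e0; exists (e / (2 * (c + 1))).
  have E : e / (2 * (c + 1)) + e / (2 * (c + 1)) = e / (c + 1).
    by field; rewrite gt_eqF.
  rewrite divr_gt0 ?mulr_gt0// E; split=> //.
    rewrite mulrCA gtr_pMr// ltr_pdivrMr// mul1r; lra.
  by rewrite ler_pdivrMr// ler_peMr ?(ltW e0)//; lra.
apply/determiningP; split.
- by move=> n; exact: (simple2 algA phi).
- move=> e /key[e' [e'0 ce' le']].
  near=> n.
  have [F [AF Fe hF]] : small_in_measure e' (fun w => s n w - f w).
    by near: n; exact: sm.
  have [G [AG Ge hG]] : small_in_measure e' (fun w => t n w - g w).
    by near: n; exact: tm.
  exists (F `|` G); split=> [||w]; first exact: algebraU.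
    by rewrite (le_lt_trans (fa_leU AF AG))// (lt_le_trans _ le')// ltrD.
  apply: contraPP => /not_orP[nF nG].
  apply/negP; rewrite -leNgt (le_trans (lip _ _ _ _))//.
  rewrite (le_trans _ (ltW ce'))// ler_wpM2l// lerD//.
    by rewrite leNgt; apply/negP => /hF.
  by rewrite leNgt; apply/negP => /hG.
- move=> e /key[e' [e'0 ce' le']].
  have [N hN] := sc _ e'0; have [M hM] := tc _ e'0.
  exists (maxn N M) => n m; rewrite !geq_max => /andP[Nn Mn] /andP[Nm Mm].
  have sn := simple2 algA (fun x y => `|x - y|) (ss n) (ss m).
  have tn := simple2 algA (fun x y => `|x - y|) (ts n) (ts m).
  have stn := simple2 algA (fun x y => x + y) sn tn.
  have := hN _ _ Nn Nm; have := hM _ _ Mn Mm.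
  set a := I _ => ha; set b := I _ => hb.
  have : I (fun w => `|phi (s n w) (t n w) - phi (s m w) (t m w)|) <= c * (b + a).
    rewrite -(simple_integralD algA prob_mu sn tn) -(simple_integralZ algA prob_mu _ stn).
    apply: (simple_integral_le algA prob_mu) => //.
      by apply: (simple2 algA (fun x y => `|x - y|)); exact: (simple2 algA phi).
    exact: (simple1 algA (fun x => c * x)).
  have : c * (b + a) <= c * (e' + e').
    by rewrite ler_wpM2l// lerD// ltW.
  lra.
Unshelve. all: by end_near. Qed.

Lemma determining_cst f : simple A f -> determining A mu (fun=> f) f.
Proof.
case: algA => -[A0 _ _] _ sf; apply/determiningP; split=> // e e0.
  near=> n; exists set0; rewrite (fa_set0 algA prob_mu); split=> // w.
  by rewrite subrr normr0 ltNge (ltW e0).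
exists 0%N => _ _ _ _.
rewrite (_ : (fun w => _) = fun=> 0); last first.
  by apply/funext => w; rewrite subrr normr0.
by rewrite (simple_integral_cst algA prob_mu).
Unshelve. all: by end_near. Qed.

Lemma determining1 (c : R) (phi : R -> R) s f : 0 <= c ->
  (forall x x', `|phi x - phi x'| <= c * `|x - x'|) ->
  determining A mu s f ->
  determining A mu (fun n w => phi (s n w)) (fun w => phi (f w)).
Proof.
move=> c0 lip sf.
apply: (determining2 (c := c) (phi := fun x _ => phi x) _ _ sf sf) => // x x' y y'.
by rewrite (le_trans (lip _ _))// ler_wpM2l// lerDl.
Qed.

Lemma determiningD s t f g : determining A mu s f -> determining A mu t g ->
  determining A mu (fun n w => s n w + t n w) (fun w => f w + g w).
Proof.
apply: (determining2 (c := 1) (phi := fun x y => x + y)) => // x x' y y'.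
by rewrite mul1r opprD addrACA ler_normD.
Qed.

Lemma determiningB s t f g : determining A mu s f -> determining A mu t g ->
  determining A mu (fun n w => s n w - t n w) (fun w => f w - g w).
Proof.
apply: (determining2 (c := 1) (phi := fun x y => x - y)) => // x x' y y'.
rewrite mul1r (distrC y) (_ : _ - _ = (x - x') + (y' - y)) ?ler_normD//; lra.
Qed.

Lemma determiningZ (a : R) s f : determining A mu s f ->
  determining A mu (fun n w => a * s n w) (fun w => a * f w).
Proof.
apply: (determining1 (c := `|a|) (phi := fun x => a * x)) => // x x'.
by rewrite -mulrBr normrM.
Qed.

Lemma determining_norm s f : determining A mu s f ->
  determining A mu (fun n w => `|s n w|) (fun w => `|f w|).
Proof.
apply: (determining1 (c := 1) (phi := fun x => `|x|)) => // x x'.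
by rewrite mul1r ler_dist_dist.
Qed.

Lemma simple_integral_dist (u v : Omega -> R) : simple A u -> simple A v ->
  `|I u - I v| <= I (fun w => `|u w - v w|).
Proof.
move=> su sv; rewrite -(simple_integralB algA prob_mu su sv).
apply: (ler_norm_simple_integral algA prob_mu).
exact: (simple2 algA (fun x y => x - y)).
Qed.

Lemma determining_is_cvg s f : determining A mu s f -> cvg (I (s n) @[n --> \oo]).
Proof.
move=> /determiningP[ss _ sc]; apply/cauchy_cvgP/cauchy_ballP => e e0.
have [N hN] := sc _ e0.
exists ([set x | exists2 n, (N <= n)%N & x = I (s n)],
        [set x | exists2 n, (N <= n)%N & x = I (s n)]) => /=.
  by split; exists N => // n Nn; exists n.
move=> [_ _] [/= [n Nn ->] [m Nm ->]].
rewrite /ball/= (le_lt_trans _ (hN _ _ Nn Nm))//.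
exact: simple_integral_dist.
Qed.

(* Off the set [G] where [`|u n| > e] the integrand is at most [e], while on
   [G] it is at most [`|u n - u N| + `|u N|] with [u N] bounded. *)
Lemma determining0_cvg (u : nat -> Omega -> R) : determining A mu u (fun=> 0) ->
  I (fun w => `|u n w|) @[n --> \oo] --> 0.
Proof.
move=> /determiningP[us um uc]; apply/cvgr0Pnorm_le => e e0.
have e30 : 0 < e / 3 by rewrite divr_gt0.
have [N hN] := uc _ e30; have [M M0 uM] := simple_range_bounded (us N).
(* The first bound caps [u n] off [G]; the second makes [M * mu G] at most [e / 3]. *)
have e1 : 0 < Num.min (e / 3) (e / 3 / (M + 1)).
  by rewrite lt_min e30 divr_gt0//; lra.
near=> n.
have Nn : (N <= n)%N by near: n; exact: nbhs_infty_ge.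
have [G [AG Ge hG]] : small_in_measure (Num.min (e / 3) (e / 3 / (M + 1)))
    (fun w => u n w - 0) by near: n; exact: um.
have su : simple A (fun w => `|u n w|) := simple1 algA _ (us n).
rewrite ger0_norm; last exact: (simple_integral_ge0 prob_mu).
have sd := simple2 algA (fun x y => `|x - y|) (us n) (us N).
have sG := @simple_indic R _ _ algA _ AG.
have sMG := simple1 algA (fun x => M * x) sG.
have sc3 := simple_cst algA (e / 3).
have sMGe := simple2 algA (fun x y => x + y) sMG sc3.
have : I (fun w => `|u n w|) <=
    I (fun w => `|u n w - u N w| + (M * \1_G w + e / 3)).
  apply: (simple_integral_le algA prob_mu) => // [|w].
    exact: (simple2 algA (fun x y => x + y)).
  have [Gw|nG] := pselect (G w).
    rewrite indicE mem_set// mulr1 -[X in `|X| <= _](subrK (u N w)).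
    by have := ler_normD (u n w - u N w) (u N w); have := uM w; lra.
  rewrite indicE memNset// mulr0 add0r.
  have : `|u n w| <= e / 3.
    rewrite leNgt; apply/negP => h; apply: nG; apply: hG.
    by rewrite subr0 (le_lt_trans _ h)// ge_min lexx.
  by have := normr_ge0 (u n w - u N w); lra.
rewrite (simple_integralD algA prob_mu sd sMGe).
rewrite (simple_integralD algA prob_mu sMG sc3).
rewrite (simple_integralZ algA prob_mu M sG).
rewrite (simple_integral_indic algA prob_mu AG) (simple_integral_cst algA prob_mu).
have := hN _ _ Nn (leqnn N).
have : M * mu G <= e / 3.
  have : mu G <= e / 3 / (M + 1).
    by rewrite (le_trans (ltW Ge))// ge_min lexx orbT.
  move/(ler_wpM2l M0)/le_trans; apply.
  by rewrite mulrCA ler_piMr ?(ltW e30)// ler_pdivrMr ?mul1r; lra.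
lra.
Unshelve. all: by end_near. Qed.

(** The value chosen by [get] is the limit along some determining sequence [t]. Since [s n - t n]
    determines 0, [determining0_cvg] forces the integrals of [s n] to the same limit. *)
Lemma fa_integral_cvg s f : determining A mu s f ->
  I (s n) @[n --> \oo] --> fa_integral A mu f.
Proof.
move=> sf; have sl := determining_is_cvg sf.
have [t tf tl] : [set l : R | exists2 s, determining A mu s f &
    I (s n) @[n --> \oo] --> l] (fa_integral A mu f).
  by apply: getPex; exists (lim (I (s n) @[n --> \oo])), s.
have d0 : determining A mu (fun n w => s n w - t n w) (fun=> 0).
  rewrite (_ : (fun=> 0) = (fun w => f w - f w)); last first.
    by apply/funext => w; rewrite subrr.
  exact: determiningB.
have /determining0_cvg h := d0.
have st0 : I (s n) - I (t n) @[n --> \oo] --> 0.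
  apply/cvgr0Pnorm_lt => e e0; move/cvgr0Pnorm_lt: h => /(_ _ e0).
  have [[ss _ _] [ts _ _]] := (sf, tf).
  apply: filterS => n; apply: le_lt_trans.
  by rewrite (le_trans (simple_integral_dist (ss n) (ts n)))// ler_norm.
rewrite -[fa_integral A mu f]addr0 addrC.
rewrite (_ : (fun n => I (s n)) = (fun n => I (s n) - I (t n) + I (t n))).
  exact: cvgD.
by apply/funext => n; rewrite subrK.
Qed.

Lemma fa_integralE s f l : determining A mu s f ->
  I (s n) @[n --> \oo] --> l -> fa_integral A mu f = l.
Proof. by move=> /fa_integral_cvg h1 h2; exact: cvg_unique h1 h2. Qed.

(** * Linearity, monotonicity and density of simple functions in [L(mu)] *)

Local Notation L := (integrable_fa A mu).
Local Notation J := (fa_integral A mu).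

Lemma fa_integrableD f g : L f -> L g -> L (fun w => f w + g w).
Proof. by move=> [s sf] [t tg]; eexists; exact: determiningD sf tg. Qed.

Lemma fa_integrableB f g : L f -> L g -> L (fun w => f w - g w).
Proof. by move=> [s sf] [t tg]; eexists; exact: determiningB sf tg. Qed.

Lemma fa_integrableZ (a : R) f : L f -> L (fun w => a * f w).
Proof. by move=> [s sf]; eexists; exact: determiningZ sf. Qed.

Lemma fa_integrable_norm f : L f -> L (fun w => `|f w|).
Proof. by move=> [s sf]; eexists; exact: determining_norm sf. Qed.

Lemma fa_integrable_simple f : simple A f -> L f.
Proof. by move=> sf; eexists; exact: determining_cst. Qed.

Lemma fa_integral_simple f : simple A f -> J f = I f.
Proof. by move=> sf; apply: (fa_integralE (determining_cst sf)); exact: cvg_cst. Qed.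

Lemma fa_integralD f g : L f -> L g -> J (fun w => f w + g w) = J f + J g.
Proof.
move=> [s sf] [t tg]; apply: (fa_integralE (determiningD sf tg)).
have [[ss _ _] [ts _ _]] := (sf, tg).
under eq_fun do rewrite (simple_integralD algA prob_mu (ss _) (ts _)).
by apply: cvgD; exact: fa_integral_cvg.
Qed.

Lemma fa_integralZ (a : R) f : L f -> J (fun w => a * f w) = a * J f.
Proof.
move=> [s sf]; apply: (fa_integralE (determiningZ a sf)).
have [ss _ _] := sf.
under eq_fun do rewrite (simple_integralZ algA prob_mu _ (ss _)).
by apply: cvgMr; exact: fa_integral_cvg.
Qed.

Lemma fa_integralB f g : L f -> L g -> J (fun w => f w - g w) = J f - J g.
Proof.
move=> Lf Lg; rewrite -mulN1r -fa_integralZ// -fa_integralD//; last exact: fa_integrableZ.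
by congr fa_integral; apply/funext => w; rewrite mulN1r.
Qed.

(** A determining sequence for [f] may take negative values, but its absolute values determine [f]
    as well and have nonnegative integrals. *)
Lemma fa_integral_ge0 f : L f -> (forall w, 0 <= f w) -> 0 <= J f.
Proof.
move=> [s sf] f0; have := fa_integral_cvg (determining_norm sf).
rewrite (_ : (fun w => `|f w|) = f); last by apply/funext => w; rewrite ger0_norm.
move=> h; rewrite -(cvg_lim _ h)//; apply: limr_ge; first by apply/cvg_ex; exists (J f).
apply: nearW => n; case: sf => ss _ _.
by apply: (simple_integral_ge0 prob_mu) => //; exact: (simple1 algA).
Qed.

Lemma fa_integral_le f g : L f -> L g -> (forall w, f w <= g w) -> J f <= J g.
Proof.
move=> Lf Lg fg; rewrite -subr_ge0 -fa_integralB//.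
by apply: fa_integral_ge0 => [|w]; [exact: fa_integrableB|rewrite subr_ge0].
Qed.

Lemma fa_integral_cst (a : R) : J (fun=> a) = a.
Proof.
by rewrite fa_integral_simple ?(simple_integral_cst algA prob_mu)//; exact: simple_cst.
Qed.

(** For fixed [n], the functions [|s m - s n|] determine [|f - s n|] as [m] grows, so the Cauchy
    condition bounds the norm in the limit. *)
Lemma L1_norm_determining s f : determining A mu s f ->
  L1_norm A mu (fun w => f w - s n w) @[n --> \oo] --> 0.
Proof.
move=> sf; have /determiningP[ss _ sc] := sf.
apply/cvgr0Pnorm_le => e e0; have [N hN] := sc _ e0.
near=> n; have Nn : (N <= n)%N by near: n; exact: nbhs_infty_ge.
have dn := determining_norm (determiningB sf (determining_cst (ss n))).
rewrite ger0_norm; last by apply: fa_integral_ge0 => [|//]; eexists; exact: dn.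
have h := fa_integral_cvg dn; rewrite /L1_norm -(cvg_lim _ h)//.
apply: limr_le; first by apply/cvg_ex; exists (J (fun w => `|f w - s n w|)).
by exists N => // m Nm /=; apply: ltW; exact: hN.
Unshelve. all: by end_near. Qed.

End Determining.

(** * Linear functionals on functions with finite range *)

Section FimfunLmodule.
Context (T : Type) (R : realType).

(** With the instances that follow, functions of finite range form a module over [R], the space to
    which Hahn-Banach is applied. *)
Lemma fimfun_scaler_closed : GRing.scaler_closed (@fimfun T R).
Proof.
move=> a f; rewrite !inE/= => /(finite_image (fun x => a * x)).
by rewrite image_comp.
Qed.

HB.instance Definition _ :=
  GRing.isScaleClosed.Build R (T -> R) (@fimfun T R) fimfun_scaler_closed.
HB.instance Definition _ := [SubZmodule_isSubLmodule of {fimfun T >-> R} by <:].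

End FimfunLmodule.

Section Indicator.
Context {R : realType} {Omega : Type}.
Implicit Types (E F : set Omega) (f : {fimfun Omega >-> R}).

Lemma finite_range_indic E : (\1_E : Omega -> R) \in fimfun.
Proof.
apply/mem_set; apply: (@sub_finite_set _ _ [set 0; 1]) => // _ [w _ <-].
by rewrite indicE; case: (_ \in _); [right|left].
Qed.

Definition fim_indic E : {fimfun Omega >-> R} := fimfun_Sub (finite_range_indic E).

Lemma fim_indicU E F : E `&` F = set0 ->
  fim_indic (E `|` F) = fim_indic E + fim_indic F.
Proof.
move=> EF; apply/fimfuneqP => w /=; rewrite -[RHS]/(\1_E w + \1_F w) !indicE in_setU.
case: (boolP (w \in E)) => [/set_mem Ew|_]; last by rewrite add0r.
case: (boolP (w \in F)) => [/set_mem Fw|_]; last by rewrite addr0.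
by have : set0 w by rewrite -EF.
Qed.

Lemma fimfun_decomp f :
  f = \sum_(y <- fset_set (range f)) y *: fim_indic (f @^-1` [set y]).
Proof.
apply/fimfuneqP => w; rewrite fimfun_sum [LHS]fimfunE fsbig_finite//.
Qed.

(** Linearity on the decomposition into indicators; this turns the Hahn-Banach functional into a set
    function. *)
Lemma scalar_fimfunE (g : {scalar {fimfun Omega >-> R}}) f :
  g f = simple_integral (fun E => g (fim_indic E)) f.
Proof.
rewrite {1}[f]fimfun_decomp linear_sum /simple_integral fsbig_finite//.
by apply: eq_bigr => y _; rewrite linearZ.
Qed.

End Indicator.

(** * Separation *)

Section Separation.
Context {R : realType} {Omega : Type}.
Implicit Types (K : set (Omega -> R)) (A : set (set Omega)).

Lemma separating_no_sure_wins K (m : set Omega -> R) :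
  separating_probabilities K m ->
  no_sure_wins (L1_closure setT m (cone_sub_simple setT K)).
Proof.
move=> [pm Km mK] [f [Lf fcl] f1].
have algT : set_algebra (setT : set (set Omega)) by [].
(* Distance 1 already gives a contradiction: [f] has integral at least 1 and [k - s] at most 0. *)
have [_ [k Kk [s [ss s0] <-]]] := fcl 1 ltr01.
have Lk := Km _ Kk; have Ls := fa_integrable_simple algT pm ss.
have k0 : fa_integral setT m k <= 0.
  by rewrite -lee_fin (le_trans _ mK)//; apply: ereal_sup_ubound; exists k.
have Lks := fa_integrableB algT pm Lk Ls.
have Lfks := fa_integrableB algT pm Lf Lks.
have : fa_integral setT m f - (fa_integral setT m k - fa_integral setT m s) <=
    L1_norm setT m (f - (k - s)).
  rewrite -!(fa_integralB algT pm)//.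
  apply: (fa_integral_le algT pm) => // [|w]; last exact: ler_norm.
  exact: (fa_integrable_norm algT pm Lfks).
have : 0 <= fa_integral setT m s by exact: (fa_integral_ge0 algT pm).
have : 1 <= fa_integral setT m f.
  rewrite -(fa_integral_cst algT pm 1).
  apply: (fa_integral_le algT pm) => //.
  exact/(fa_integrable_simple algT pm)/simple_cst.
lra.
Qed.

(** * From the absence of sure wins to a separating probability *)

Section Converse.
Variables (A : set (set Omega)) (mu : set Omega -> R) (K : set (Omega -> R)).
Hypotheses (algA : set_algebra A) (prob_mu : fa_probability A mu).
Hypotheses (coneK : convex_cone K) (KL : K `<=` integrable_fa A mu).
Local Notation L := (integrable_fa A mu).
Local Notation J := (fa_integral A mu).

(** Bounds from above by elements of [L(mu)] make sense for every [f], so a functional built on them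
    reaches sets outside [A]. *)
Definition majorant (f k h : Omega -> R) (t : R) : Prop :=
  [/\ K k, L h, (forall w, 0 <= h w) & forall w, f w <= t + k w + h w].

(* If [1 <= k + h] with [J h] small, then [k + h - 1 >= 0] is approximated in
   [L(mu)] by nonnegative simple functions [s], and [k - s] is close to [1]. *)
Lemma no_sure_wins_dist :
  no_sure_wins (L1_closure A mu (cone_sub_simple A K)) ->
  exists2 d : R, 0 < d & forall k h, majorant (fun=> 1) k h 0 -> d <= J h.
Proof.
move=> nsw; apply: contrapT => nd; apply: nsw; exists (fun=> 1) => //.
have L1 : L (fun=> 1) by exact/(fa_integrable_simple algA prob_mu)/simple_cst.
(* One half of [e] pays for [h], the other for approximating [k + h - 1] by a simple function. *)
split=> // e e0; have e20 : 0 < e / 2 by rewrite divr_gt0.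
have [k [h [[Kk Lh h0 kh] Jh]]] : exists k h, majorant (fun=> 1) k h 0 /\ J h < e / 2.
  apply: contrapT => H; apply: nd; exists (e / 2) => // k h kh.
  by rewrite leNgt; apply/negP => Jh; apply: H; exists k, h.
have Lk := KL Kk.
pose q w := k w + h w - 1.
have Lq : L q by apply: fa_integrableB => //; exact: fa_integrableD.
have q0 w : 0 <= q w by have := kh w; rewrite /q; lra.
have [s sq] := Lq.
have sq' : determining A mu (fun n w => `|s n w|) q.
  rewrite (_ : q = fun w => `|q w|); first exact: determining_norm.
  by apply/funext => w; rewrite ger0_norm.
have /cvgr0Pnorm_lt/(_ _ e20)[N _ /(_ N (leqnn N))] :=
  L1_norm_determining algA prob_mu sq'.
have [/(_ N) ss _ _] := sq'.
set v := fun w => `|s N w| in ss *; move=> qv.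
exists (k - v); first by exists k => //; exists v => //; split=> // w; exact: normr_ge0.
have Lv := fa_integrable_simple algA prob_mu ss.
have Lqv := fa_integrable_norm algA prob_mu (fa_integrableB algA prob_mu Lq Lv).
have : L1_norm A mu ((fun=> 1) - (k - v)) <= J h + L1_norm A mu (fun w => q w - v w).
  rewrite -fa_integralD//; apply: fa_integral_le => //.
  - apply: fa_integrable_norm => //; apply: fa_integrableB => //.
    exact: fa_integrableB.
  - exact: fa_integrableD.
  - move=> w; rewrite (_ : _ w = h w - (q w - v w)); last first.
      by rewrite /q -[LHS]/(1 - (k w - v w)); lra.
    by rewrite (le_trans (ler_normB _ _))// (ger0_norm (h0 _)).
have := le_lt_trans (ler_norm _) qv; lra.
Qed.


(** * The sublinear gauge and the probability it dominates *)

Section GaugeSeparation.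
Variable d : R.
Hypotheses (d0 : 0 < d)
  (dist : forall k h, majorant (fun=> 1) k h 0 -> d <= J h).
Implicit Types f : {fimfun Omega >-> R}.

Lemma simple_fimfun f : simple setT f.
Proof. by split. Qed.

(** The weight [1 / d] prices errors so that an error replacing one unit of the constant costs at
    least that unit; this keeps the infimum finite. *)
Definition gauge f : R :=
  inf [set x | exists t k h, majorant f k h t /\ x = t + J h / d].

Lemma cone0 : K (fun=> 0).
Proof.
case: coneK => -[k Kk] _ KZ; have := KZ 0 k (lexx _) Kk.
by rewrite scale0r.
Qed.

Lemma cone_scale (a : R) k : 0 <= a -> K k -> K (fun w => a * k w).
Proof. by case: coneK => _ _ KZ a0 Kk; exact: KZ. Qed.

(** If [t < - M], then [k + h >= - (M + t) > 0]. Dividing by this constant gives a majorant of 1, so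
    [dist] yields [J h >= - (M + t) * d]. *)
Lemma majorant_lb f k h t M : (forall w, - M <= f w) -> majorant f k h t ->
  - M <= t + J h / d.
Proof.
move=> fM [Kk Lh h0 fkh]; have Jh : 0 <= J h / d.
  by rewrite divr_ge0 ?(ltW d0)//; exact: (fa_integral_ge0 algA).
have [Mt|] := leP (- M) t; first by lra.
move=> Mt; have a0 : 0 < - (M + t) by lra.
have : majorant (fun=> 1) (fun w => (- (M + t))^-1 * k w)
                          (fun w => (- (M + t))^-1 * h w) 0.
  split=> [|||w].
  - by apply: cone_scale => //; rewrite invr_ge0 ltW.
  - exact: fa_integrableZ.
  - by move=> w; rewrite mulr_ge0// invr_ge0 ltW.
  - rewrite add0r -mulrDr ler_pdivlMl// mulr1.
    by have := fM w; have := fkh w; lra.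
move/dist; rewrite fa_integralZ// ler_pdivlMl// => h1.
have : - (M + t) <= J h / d by rewrite ler_pdivlMr.
lra.
Qed.

Lemma gauge_le f k h t : majorant f k h t -> gauge f <= t + J h / d.
Proof.
move=> fkh; have [M _ fM] := simple_range_bounded (simple_fimfun f).
apply: ge_inf; last by exists t, k, h.
exists (- M) => _ [t' [k' [h' [maj ->]]]]; apply: majorant_lb maj => w.
by have := fM w; rewrite ler_norml => /andP[].
Qed.

Lemma fa_integrable0 : L (fun=> 0).
Proof. exact/(fa_integrable_simple algA prob_mu)/simple_cst. Qed.

Lemma gauge_adherent f e : 0 < e ->
  exists k h t, majorant f k h t /\ t + J h / d < gauge f + e.
Proof.
move=> e0; have [M _ fM] := simple_range_bounded (simple_fimfun f).
have /(inf_adherent e0)[_ [t [k [h [fkh ->]]]] ?] : has_inf [set x |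
    exists t k h, majorant f k h t /\ x = t + J h / d]; last by exists k, h, t.
split.
  exists (M + J (fun=> 0) / d), M, (fun=> 0), (fun=> 0); split=> //.
  split=> [|||w] //; [exact: cone0|exact: fa_integrable0|].
  by rewrite !addr0 (le_trans (ler_norm _)).
exists (- M) => _ [t [k [h [maj ->]]]]; apply: majorant_lb maj => w.
by have := fM w; rewrite ler_norml => /andP[].
Qed.

(** Near-optimal majorants can be added and scaled because [K] is a convex cone and [J] is
    linear. *)
Lemma gauge_sublinear : sublinear gauge.
Proof.
split=> [f g|a f].
  apply/ler_addgt0Pr => e e0; have e20 : 0 < e / 2 by rewrite divr_gt0.
  have [k [h [t [[Kk Lh h0 fkh] ht]]]] := gauge_adherent f e20.
  have [k' [h' [t' [[Kk' Lh' h'0 gkh'] ht']]]] := gauge_adherent g e20.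
  have maj : majorant (f + g) (k + k') (fun w => h w + h' w) (t + t').
    split=> [|||w]; first by case: coneK => _ KD _; exact: KD.
    - exact: fa_integrableD.
    - by move=> w; rewrite addr_ge0.
    - rewrite -[leLHS]/(f w + g w) -[(k + k') w]/(k w + k' w).
      by have := fkh w; have := gkh' w; lra.
  by have := gauge_le maj; rewrite fa_integralD// mulrDl; lra.
rewrite le_eqVlt => /predU1P[<-|a0].
  have maj : majorant ((0 : R) *: f) (fun=> 0) (fun=> 0) 0.
    split=> [|||w] //; [exact: cone0|exact: fa_integrable0|].
    by rewrite -[leLHS]/(0 * f w) mul0r !addr0.
  by have := gauge_le maj; rewrite (fa_integral_cst algA prob_mu) !mul0r addr0.
rewrite -ler_pdivrMl//; apply/ler_addgt0Pr => e e0.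
have [k [h [t [[Kk Lh h0 fkh] ht]]]] := gauge_adherent f e0.
have maj : majorant (a *: f) (fun w => a * k w) (fun w => a * h w) (a * t).
  split=> [|||w]; first by apply: cone_scale => //; exact: ltW.
  - exact: fa_integrableZ.
  - by move=> w; rewrite mulr_ge0// ltW.
  - by rewrite -[leLHS]/(a * f w) -!mulrDr ler_pM2l.
have := gauge_le maj; rewrite fa_integralZ// -mulrA -mulrDr -ler_pdivrMl//; lra.
Qed.

Lemma dominated_separating (g : {scalar {fimfun Omega >-> R}}) :
  (forall f, g f <= gauge f) -> separating_probabilities K (fun E => g (fim_indic E)).
Proof.
move=> gle; set m := fun E => _.
have gI f : g f = simple_integral m f := scalar_fimfunE g f.
have L0 := fa_integrable0.
have J0 : J (fun=> 0) = 0 by exact: (fa_integral_cst algA prob_mu).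
have mU E F : E `&` F = set0 -> m (E `|` F) = m E + m F.
  by move=> EF; rewrite /m fim_indicU// linearD.
have m_ge0 E : 0 <= m E.
  have maj : majorant (- fim_indic E) (fun=> 0) (fun=> 0) 0.
    split=> [|||w] //; first exact: cone0.
    by rewrite -[leLHS]/(- \1_E w) !addr0 oppr_le0 indicE; case: (_ \in _).
  have := gauge_le maj; rewrite J0 mul0r addr0 => h.
  by have := le_trans (gle _) h; rewrite linearN oppr_le0.
(* The constant [t] may have either sign and costs exactly itself: bounding both 1 and -1 fixes the
   total mass. *)
have mT : m setT = 1.
  have maj1 : majorant (fim_indic setT) (fun=> 0) (fun=> 0) 1.
    split=> [|||w] //; first exact: cone0.
    by rewrite -[leLHS]/(\1_setT w) indicT !addr0.
  have majN1 : majorant (- fim_indic setT) (fun=> 0) (fun=> 0) (- 1).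
    split=> [|||w] //; first exact: cone0.
    by rewrite -[leLHS]/(- \1_setT w) indicT !addr0.
  have := le_trans (gle _) (gauge_le maj1).
  have := le_trans (gle _) (gauge_le majN1).
  by rewrite linearN J0 mul0r !addr0 /m; lra.
(* For [E] in [A] the indicator is its own error term, at price [mu E / d]. *)
have m_le E : A E -> m E <= mu E / d.
  move=> AE; have sE := @simple_indic R _ _ algA _ AE.
  have maj : majorant (fim_indic E) (fun=> 0) \1_E 0.
    split=> [|||w] //; first exact: cone0.
    - exact: fa_integrable_simple.
    - by rewrite -[leLHS]/(\1_E w) !add0r.
  have := le_trans (gle _) (gauge_le maj).
  by rewrite fa_integral_simple// (simple_integral_indic algA prob_mu AE) add0r.
have pm : fa_probability setT m by split=> // E F _ _; exact: mU.
have algT : set_algebra (setT : set (set Omega)) by [].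
have sT (s : Omega -> R) : simple A s -> simple setT s by case.
(* Both integrals run over the values of [s], whose fibres lie in [A], so [m_le] compares them term
   by term. *)
have Im_le (s : Omega -> R) : simple A s -> (forall w, 0 <= s w) ->
    simple_integral m s <= simple_integral mu s / d.
  move=> [sfin sA] s0; rewrite /simple_integral mulr_fsuml !fsbig_finite//.
  rewrite big_seq [leRHS]big_seq; apply: ler_sum => y.
  rewrite in_fset_set// => /set_mem[w _ <-].
  by rewrite -mulrA ler_wpM2l// m_le.
have Kdet k s : determining A mu s k -> determining setT m s k.
  move=> /(determiningP algA prob_mu)[ss sm sc].
  apply/(determiningP algT pm); split=> [n|e e0|e e0]; first exact: sT.
    (* The bound [e * d] absorbs the factor [1 / d] lost in passing from [mu] to [m]. *)
    have e'0 : 0 < Num.min e (e * d) by rewrite lt_min e0 mulr_gt0.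
    apply: filterS (sm _ e'0) => n [F [AF Fe hF]]; exists F; split=> //.
      rewrite (le_lt_trans (m_le _ AF))// ltr_pdivrMr//.
      by rewrite (lt_le_trans Fe)// ge_min lexx orbT.
    by move=> w ew; apply: hF; rewrite (le_lt_trans _ ew)// ge_min lexx.
  have [N hN] := sc _ (mulr_gt0 e0 d0).
  exists N => n p Nn Np; rewrite (le_lt_trans (Im_le _ _ _))//.
    exact: (simple2 algA (fun x y => `|x - y|)).
  by rewrite ltr_pdivrMr// hN.
split=> // [k Kk|]; first by have [s /Kdet] := KL Kk; exists s.
apply: ge_ereal_sup => _ [k Kk <-]; rewrite lee_fin.
have [s sk] := KL Kk; have h := fa_integral_cvg algT pm (Kdet _ _ sk).
(* The sign of [m(k)] comes from here: a majorant charges nothing for [k], only for the error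
   [|k - s n|], whose integral vanishes in the limit. *)
have bnd n : simple_integral m (s n) <= L1_norm A mu (fun w => k w - s n w) / d.
  have [/(_ n) ss _ _] := sk.
  have Lks := fa_integrableB algA prob_mu (KL Kk) (fa_integrable_simple algA prob_mu ss).
  have fs : s n \in fimfun by apply/mem_set; case: ss.
  have maj : majorant (fimfun_Sub fs) k (fun w => `|k w - s n w|) 0.
    split=> // [|w]; first exact: fa_integrable_norm.
    rewrite -[leLHS]/(s n w) add0r.
    by have := ler_norm (- (k w - s n w)); rewrite normrN; lra.
  have := le_trans (gle _) (gauge_le maj).
  by rewrite gI add0r.
have := L1_norm_determining algA prob_mu sk.
move=> /cvgMl - /(_ d^-1); rewrite mul0r => h2.
rewrite -(cvg_lim _ h)// -(cvg_lim _ h2)//.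
by apply: ler_lim; [apply/cvg_ex; eexists; exact: h|
  apply/cvg_ex; eexists; exact: h2|exact: nearW].
Qed.

End GaugeSeparation.
End Converse.
End Separation.

Theorem corollary2 (R : realType) (Omega : Type) (K : set (Omega -> R)) :
  convex_cone K ->
  (separating_probabilities K !=set0 <->
   exists (A : set (set Omega)) (mu : set Omega -> R),
     [/\ set_algebra A,
         fa_probability A mu,
         K `<=` integrable_fa A mu
       & no_sure_wins (L1_closure A mu (cone_sub_simple A K))]).
Proof.
move=> coneK; split=> [[m mK]|[A [mu [algA prob_mu KL nsw]]]].
  exists setT, m; have [pm Km _] := mK; split=> //.
  exact: separating_no_sure_wins.
have [d d0 dist] := no_sure_wins_dist algA prob_mu KL nsw.
have [g gle] := hahn_banach (gauge_sublinear algA prob_mu coneK d0 dist).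
exists (fun E => g (fim_indic E)).
exact: dominated_separating gle.
Qed.
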